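(* If the circular flow number $\phi_c(G)$ of a bridgeless cubic graph $G=(V,E)$ is strictly smaller than $5$, then $G$ admits a $(3\frac13,\frac13)$-flow.
   Context: Graphs are finite and undirected; parallel edges are allowed, loops are not. A cubic graph is a graph in which every vertex has degree $3$. For real numbers $r\ge 2$ and $\alpha\ge 0$, an $(r,\alpha)$-flow in a directed graph $D=(V,E)$ is an assignment $f:E\to[1,r-1]$ such that for every vertex $x\in V$, $\left|\sum_{e\in E^+(x)}f(e)-\sum_{e\in E^-(x)}f(e)\right|\le\alpha$, where $E^+(x)$, respectively $E^-(x)$, is the set of edges directed from, respectively toward, $x$ in $D$. An undirected graph $G$ admits an $(r,\alpha)$-flow if some orientation of $G$ admits such a flow. A circular nowhere-zero $r$-flow ($r$-cnzf) is an $(r,0)$-flow, and the circular flow number $\phi_c(G)$ of a bridgeless graph $G$ is the infimum (in fact minimum) of the real numbers $r$ such that $G$ admits an $r$-cnzf. Here $3\frac13=\frac{10}3$. *)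

(* Defs.v *)
From HB Require Import structures.
From mathcomp Require Import all_boot all_order all_algebra.
From mathcomp Require Import all_classical all_reals all_analysis.

Set Implicit Arguments.
Unset Strict Implicit.
Unset Printing Implicit Defensive.

Import Order.TTheory GRing.Theory Num.Theory.
Local Open Scope ring_scope.

(* Edges are named, so parallel edges are allowed; the cardinality condition
   excludes loops. *)
Record mgraph (V E : finType) := MGraph {
  ends : E -> {set V};
  card_ends : forall e : E, #|ends e| = 2%N
}.

Record digraph (V E : finType) := Digraph { tail : E -> V; head : E -> V }.

Section Graphs.
Variables (V E : finType).
Implicit Types (G : mgraph V E) (D : digraph V E).

Definition degree G (x : V) : nat := #|[set e : E | x \in ends G e]|.

Definition cubic G : Prop := forall x : V, degree G x = 3%N.

Definition adj_without G (e : E) : rel V :=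
  fun x y => [exists e' : E, (e' != e) && (ends G e' == [set x; y])].

(* A bridge is an edge that separates its two ends: they lie in different
   components after its deletion. *)
Definition bridge G (e : E) : Prop :=
  exists x y : V, ends G e = [set x; y] /\ ~~ connect (adj_without G e) x y.

Definition bridgeless G : Prop := forall e : E, ~ bridge G e.

Definition orientation G D : Prop :=
  forall e : E, ends G e = [set tail D e; head D e].

Variable R : realType.

Definition is_flow D (r alpha : R) (f : E -> R) : Prop :=
  (forall e : E, 1 <= f e <= r - 1) /\
  (forall x : V,
     `| \sum_(e : E | tail D e == x) f e - \sum_(e : E | head D e == x) f e |
       <= alpha).

Definition admits_flow G (r alpha : R) : Prop :=
  exists D : digraph V E, orientation G D /\
    exists f : E -> R, is_flow D r alpha f.

Definition admits_cnzf G (r : R) : Prop := admits_flow G r 0.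

(* The infimum is taken in the extended reals, so that it is +oo, and not a
   default real number, when no circular nowhere-zero flow exists. *)
Definition circular_flow_number G : \bar R :=
  ereal_inf [set r%:E | r in [set r : R | 2 <= r /\ admits_cnzf G r]]%classic.

End Graphs.

(* Main.v *)
Require Import Defs.
From HB Require Import structures.
From mathcomp Require Import all_boot all_order all_algebra.
From mathcomp Require Import all_classical all_reals all_analysis.
From mathcomp Require Import ring lra zify.

Set Implicit Arguments.
Unset Strict Implicit.
Unset Printing Implicit Defensive.

Import Order.TTheory GRing.Theory Num.Theory.
Local Open Scope ring_scope.
(* Restores the projections of [digraph], shadowed by those on sequences. *)
Import Defs.

(** An [r]-cnzf [f] with [r < 5] lives on an orientation [D], and that same
    orientation carries the required bounded-excess flow.

    For a set [X] of vertices let [d+] and [d-] be the numbers of edges leaving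
    and entering [X].  Flow conservation for [f] gives [d+ <= (r - 1) d-], so
    [d+ < 4 d-], hence [d+ <= 4 d- - 1], as soon as [d- > 0], and likewise with
    [d+] and [d-] exchanged.  A function with values in [[1, 7/3]] and excess at
    most [1/3] everywhere exists, in the manner of Hoffman's circulation
    theorem, if no set [X] forces more excess than [X] can hold:
    [d+ - 7/3 d- <= |X| / 3], and the same for the reversed digraph.  This
    condition is only needed for connected [X], and there a cubic graph has
    [d+ + d- <= |X| + 2] ([card_cut_connected]).  The two bounds on cuts then
    suffice ([cnzf_connected_cut]): if [d- = 0] then [d+ = 0], and if [d- > 0]
    then
    [3 d+ - 7 d- = (d+ + d-) + 2 (d+ - 4 d-) <= (|X| + 2) - 2 = |X|].

    The circulation theorem with connected sets ([bounded_excess_of_cuts]) is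
    proved without augmenting paths: take a function [g] minimizing the sum of
    the squared excesses over the compact box of admissible functions.
    Modifying [g] on a single edge shows that the excess never decreases along
    a residual arc, that is, one along which some flow can still be moved.  If
    some [x] has excess above the bound, then so has every vertex reachable
    from [x] through residual arcs; these vertices form a connected set whose
    outgoing edges carry the least value and whose incoming edges carry the
    greatest one ([minimizer_tight_cut]), so the cut condition fails on it. *)

(** * Cuts of connected vertex sets *)

Section Digraphs.
Variables (V E : finType).
Implicit Types (D : digraph V E) (X Y : {set V}).

Definition reverse D : digraph V E := Digraph (head D) (tail D).

Definition cut_out D X : {set E} :=
  [set e | (tail D e \in X) && (head D e \notin X)].

Definition cut_in D X : {set E} := cut_out (reverse D) X.

Definition incident D (x : V) : {set E} :=
  [set e | (tail D e == x) || (head D e == x)].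

(** Connectivity of the underlying undirected graph induced on [X], in cut
    form: every smaller set around [x] is left by an edge that stays inside
    [X].  This is the form in which [X] can be built up vertex by vertex. *)
Definition connected_from D (x : V) X : Prop :=
  x \in X /\ forall Y, x \in Y -> Y \proper X ->
    exists2 e, e \in cut_out D Y :|: cut_in D Y &
               (tail D e \in X) && (head D e \in X).

Lemma connected_from_reverse D x X :
  connected_from D x X -> connected_from (reverse D) x X.
Proof.
case=> xX conn; split=> // Y xY /(conn Y xY)[e eY eX].
by exists e; [rewrite finset.setUC | rewrite andbC].
Qed.

Lemma card_cut D X :
  #|cut_out D X :|: cut_in D X| = (#|cut_out D X| + #|cut_in D X|)%N.
Proof.
rewrite cardsU (_ : _ :&: _ = finset.set0) ?cards0 ?subn0 //.
by apply/setP=> e; rewrite !inE /=; do 2 case: (_ \in X).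
Qed.

Lemma card_cut_set1 D x :
  (#|cut_out D [set x] :|: cut_in D [set x]| <= #|incident D x|)%N.
Proof.
apply/subset_leq_card/fintype.subsetP=> e; rewrite !inE /=.
by do 2 case: (_ == x).
Qed.

(** The edge [e] from [Y] to [v] is counted both in the cut of [Y] and at [v],
    but lies inside [v |: Y]. *)
Lemma card_cut_setU1 D Y v e :
  e \in cut_out D Y :|: cut_in D Y -> e \in incident D v -> v \notin Y ->
  (#|cut_out D (v |: Y) :|: cut_in D (v |: Y)| + 2 <=
   #|cut_out D Y :|: cut_in D Y| + #|incident D v|)%N.
Proof.
move=> eY ev vY.
rewrite (cardsD1 e (cut_out D Y :|: _)) eY (cardsD1 e (incident D v)) ev /=.
suff : (#|cut_out D (v |: Y) :|: cut_in D (v |: Y)| <=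
        #|((cut_out D Y :|: cut_in D Y) :\ e) :|: (incident D v :\ e)|)%N.
  move/leq_trans/(_ (leq_card_setU _ _)).
  by move: #|_ :\ e| #|_ :\ e| #|_ :|: _|; lia.
apply/subset_leq_card/fintype.subsetP=> e'.
move: eY ev; rewrite !inE /=.
have [->|_] /= := eqVneq e' e.
  have [->|_] := eqVneq (tail D e) v; have [->|_] := eqVneq (head D e) v;
    rewrite ?(negPf vY) //=;
    by case: (tail D e \in Y); case: (head D e \in Y).
move=> _ _.
have [->|_] := eqVneq (tail D e') v; have [->|_] := eqVneq (head D e') v;
  rewrite ?(negPf vY) ?orbT //=;
  by case: (tail D e' \in Y); case: (head D e' \in Y).
Qed.

(** Grow [X] from [x] by adding adjacent vertices: the first contributes at most
    three edges to the cut, and each further one destroys at least one edge of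
    the cut and creates at most two. *)
Lemma card_cut_connected D x X :
  (forall v, #|incident D v| <= 3)%N -> connected_from D x X ->
  (#|cut_out D X| + #|cut_in D X| <= #|X| + 2)%N.
Proof.
move=> deg3 [xX conn]; rewrite -card_cut.
pose P Y := [&& x \in Y, Y \subset X &
              (#|cut_out D Y :|: cut_in D Y| <= #|Y| + 2)%N].
have Px : P [set x].
  rewrite /P !inE eqxx finset.sub1set xX cards1 /=.
  exact: leq_trans (card_cut_set1 D x) (deg3 x).
have [Y /maxsetP[/and3P[xY YX cutY] maxY] _] := maxset_exists Px.
have [->//|YneqX] := eqVneq X Y.
have YpX : Y \proper X by rewrite finset.properEneq eq_sym YneqX.
have [e eY /andP[tX hX]] := conn Y xY YpX.
have [v [vX vY ev]] : exists v, [/\ v \in X, v \notin Y & e \in incident D v].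
  move: (eY); rewrite !inE /= => /orP[|] /andP[_ nY].
    by exists (head D e); rewrite !inE eqxx orbT.
  by exists (tail D e); rewrite !inE eqxx.
have PvY : P (v |: Y).
  rewrite /P !inE xY orbT finset.subUset finset.sub1set vX YX /= cardsU1 vY.
  have := card_cut_setU1 eY ev vY; have := deg3 v; move: cutY.
  by move: #|_ :|: _| #|_ :|: _| #|incident D v|; lia.
by rewrite -(maxY _ PvY (finset.subsetUr _ _)) !inE eqxx in vY.
Qed.

End Digraphs.

(** * Excess and energy *)

Section Excess.
Variables (R : realType) (V E : finType).
Implicit Types (D : digraph V E) (X : {set V}) (f g : E -> R).

Definition excess D f (x : V) : R :=
  \sum_(e : E | tail D e == x) f e - \sum_(e : E | head D e == x) f e.

Lemma excess_reverse D f x : excess (reverse D) f x = - excess D f x.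
Proof. by rewrite /excess opprB. Qed.

Lemma sum_excess D f X :
  \sum_(x in X) excess D f x =
  \sum_(e in cut_out D X) f e - \sum_(e in cut_in D X) f e.
Proof.
have endsum (p : E -> V) :
    \sum_(x in X) \sum_(e | p e == x) f e = \sum_e f e *+ (p e \in X).
  rewrite (exchange_big_dep predT) //=; apply: eq_bigr => e _.
  have [pX|pX] := boolP (p e \in X).
    rewrite (big_pred1 (p e)) // => x /=; rewrite eq_sym.
    by case: eqVneq => [->|]; rewrite ?pX ?andbF.
  rewrite big_pred0 // => x; apply/negbTE; apply: contraNN pX.
  by case/andP=> xX /eqP->.
rewrite sumrB !endsum [\sum_(e in cut_out _ _) _]big_mkcond.
rewrite [\sum_(e in cut_in _ _) _]big_mkcond -!sumrB /=.
apply: eq_bigr => e _; rewrite !inE /=.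
by do 2 case: (_ \in X); rewrite ?mulr1n ?mulr0n ?subrr ?subr0 ?sub0r.
Qed.

(** Squares, rather than a linear penalty, make the minimizers equalize the
    excess along every single edge that is not saturated. *)
Definition energy D f : R := \sum_x excess D f x ^+ 2.

Lemma energy_reverse D f : energy (reverse D) f = energy D f.
Proof. by apply: eq_bigr => x _; rewrite excess_reverse sqrrN. Qed.

Definition add_on_edge f (e0 : E) (d : R) : E -> R :=
  fun e => f e + d *+ (e == e0).

Lemma excess_add_on_edge D f e0 d x :
  excess D (add_on_edge f e0 d) x =
  excess D f x + d *+ (tail D e0 == x) - d *+ (head D e0 == x).
Proof.
have endsum (p : E -> V) : \sum_(e | p e == x) add_on_edge f e0 d e =
    \sum_(e | p e == x) f e + d *+ (p e0 == x).
  rewrite big_split /=; congr (_ + _); rewrite big_mkcond (bigD1 e0) //= eqxx.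
  rewrite big1 ?addr0 => [|e /negPf->]; first by case: eqP.
  by rewrite mulr0n; case: eqP.
by rewrite /excess !endsum; ring.
Qed.

(** The inequality is an equality unless [e] is a loop, where the energy does
    not change. *)
Lemma energy_add_on_edge D f e d :
  energy D (add_on_edge f e d) <=
  energy D f +
    2 * (d * (excess D f (tail D e) - excess D f (head D e)) + d ^+ 2).
Proof.
have sum1 (y : V) (F : V -> R) : \sum_x F x *+ (y == x) = F y.
  by rewrite (bigD1 y) //= eqxx big1 ?addr0 // => x /negPf; rewrite eq_sym => ->.
rewrite -(sum1 (tail D e)) -(sum1 (head D e)) -sumrB mulr_sumr.
(* Distributing [2 d ^+ 2] over the two ends of [e] allows a termwise proof. *)
have -> : d ^+ 2 =
    \sum_x (2^-1 * (d ^+ 2 *+ (tail D e == x) + d ^+ 2 *+ (head D e == x))).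
  rewrite -mulr_sumr big_split /= (sum1 _ (fun=> d ^+ 2)).
  by rewrite (sum1 _ (fun=> d ^+ 2)); field.
rewrite -big_split mulr_sumr -big_split /=.
apply: ler_sum => x _; rewrite excess_add_on_edge.
have := sqr_ge0 d.
by case: (tail D e == x); case: (head D e == x); rewrite !(mulr1n, mulr0n); nra.
Qed.

(** * Minimizers of the energy *)

Definition in_box (lo hi : R) f : Prop := forall e, lo <= f e <= hi.

Definition minimizes_energy D (lo hi : R) g : Prop :=
  in_box lo hi g /\ forall f, in_box lo hi f -> energy D g <= energy D f.

Lemma minimizer_add_on_edge D lo hi g e d :
  minimizes_energy D lo hi g -> lo <= g e + d <= hi ->
  0 <= d * (excess D g (tail D e) - excess D g (head D e)) + d ^+ 2.
Proof.
case=> gbox gmin ed.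
have /gmin : in_box lo hi (add_on_edge g e d).
  move=> e'; rewrite /add_on_edge; have [->//|_] := eqVneq e' e.
  by rewrite mulr0n addr0.
by move=> /le_trans/(_ (energy_add_on_edge D g e d)); lra.
Qed.

(** If the excess dropped by [s > 0] along [e], removing a small amount [d]
    from [e] would change the energy by at most [2 (d ^+ 2 - d * s) < 0]. *)
Lemma minimizer_lower D lo hi g e : minimizes_energy D lo hi g -> lo < g e ->
  excess D g (tail D e) <= excess D g (head D e).
Proof.
move=> gmin lt_lo; rewrite leNgt; apply/negP=> lt_ex.
have /andP[_ ge_hi] := gmin.1 e.
pose s := excess D g (tail D e) - excess D g (head D e).
have s_gt0 : 0 < s by rewrite subr_gt0.
pose d := Num.min (g e - lo) (s / 2).
have d_gt0 : 0 < d by rewrite lt_min subr_gt0 lt_lo divr_gt0.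
have d_le : d <= g e - lo /\ d <= s / 2 by rewrite !ge_min !lexx orbT.
have := @minimizer_add_on_edge _ _ _ _ e (- d) gmin; rewrite -/s.
have -> : lo <= g e - d <= hi by move: d_le => [? ?]; lra.
by move=> /(_ isT); case: d_le => _; nra.
Qed.

Lemma minimizer_raise D lo hi g e : minimizes_energy D lo hi g -> g e < hi ->
  excess D g (head D e) <= excess D g (tail D e).
Proof.
move=> gmin lt_hi; rewrite leNgt; apply/negP=> lt_ex.
have /andP[ge_lo _] := gmin.1 e.
pose s := excess D g (head D e) - excess D g (tail D e).
have s_gt0 : 0 < s by rewrite subr_gt0.
pose d := Num.min (hi - g e) (s / 2).
have d_gt0 : 0 < d by rewrite lt_min subr_gt0 lt_hi divr_gt0.
have d_le : d <= hi - g e /\ d <= s / 2 by rewrite !ge_min !lexx orbT.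
have := @minimizer_add_on_edge _ _ _ _ e d gmin.
rewrite -[excess D g (tail _ _) - _]opprB -/s.
have -> : lo <= g e + d <= hi by move: d_le => [? ?]; lra.
by move=> /(_ isT); case: d_le => _; nra.
Qed.

(** The box is compact by Tychonoff's theorem and the energy is continuous for
    the product topology. *)
Lemma minimizer_exists D lo hi : lo <= hi -> exists g, minimizes_energy D lo hi g.
Proof.
move=> lohi.
pose A : set (E -> R) := [set f | forall e, `[lo, hi]%classic (f e)]%classic.
have Abox f : A f <-> in_box lo hi f.
  by split=> Af e; have := Af e; rewrite /= in_itv.
have A0 : (A !=set0)%classic.
  by exists (fun=> lo); apply/Abox => e; rewrite lexx.
have cA : compact (A : set {ptws E -> R^o}).
  apply: (@tychonoff E (fun=> R^o) (fun=> `[lo, hi]%classic)) => e.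
  exact: segment_compact.
have cE : continuous (energy D : {ptws E -> R^o} -> R^o).
  have addc := @add_continuous R^o.
  have sumc (p : E -> V) x : continuous
      (fun f : {ptws E -> R^o} => \sum_(e | p e == x) f e : R^o).
    apply: (continuous_big (F := fun e (f : {ptws E -> R^o}) => f e) addc) => //.
    move=> e _.
    exact: proj_continuous.
  pose F x (f : {ptws E -> R^o}) : R^o := excess D f x ^+ 2.
  apply: (continuous_big (F := F) addc) => // x _ f.
  have exc := continuousB (sumc (tail D) x f) (sumc (head D) x f).
  exact: (continuousM exc exc).
have [g /set_mem /Abox gA gmin] :=
  @compact_EVT_min {ptws E -> R^o} R _ A A0 cA (continuous_subspaceT cE).
by exists g; split=> // f fbox; apply: gmin; apply/mem_set/Abox.
Qed.

(** The set is the set of vertices reachable from [x] through residual arcs: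
    no residual arc leaves it, so its outgoing edges cannot be lowered and its
    incoming ones cannot be raised. *)
Lemma minimizer_tight_cut D lo hi g x : minimizes_energy D lo hi g ->
  exists X, [/\ connected_from D x X,
    forall y, y \in X -> excess D g x <= excess D g y &
    \sum_(y in X) excess D g y = lo * #|cut_out D X|%:R - hi * #|cut_in D X|%:R].
Proof.
move=> gmin; have [gbox _] := gmin.
(* [res u v]: a transfer on a single edge can decrease the excess of [u] and
   increase that of [v]. *)
pose res : rel V := fun u v => [exists e,
  (tail D e == u) && (head D e == v) && (lo < g e) ||
  (head D e == u) && (tail D e == v) && (g e < hi)].
have res_mono u v : res u v -> excess D g u <= excess D g v.
  case/existsP=> e /orP[] /andP[/andP[/eqP<- /eqP<-]].
    exact: (minimizer_lower gmin).
  exact: (minimizer_raise gmin).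
have conn_mono u v : connect res u v -> excess D g u <= excess D g v.
  case/connectP=> p; elim: p u => [|w p IHp] u /=; first by move=> _ ->.
  by case/andP=> /res_mono uw pth vl; rewrite (le_trans uw) ?IHp.
pose X := [set y | connect res x y].
have xX : x \in X by rewrite inE.
have resX u v : u \in X -> res u v -> v \in X.
  by rewrite !inE => xu /connect1; apply: connect_trans.
exists X; split.
- split=> // Y xY /properP[YX [z zX zY]].
  (* The first arc that leaves [Y] on a residual path from [x] to [z]. *)
  move: (zX); rewrite inE => /connectP[p].
  move: {xX}(xX); move: {xY}(xY); move: {1 2 3 4}x.
  elim: p => [|v p IHp] u uY uX /=; first by move=> _ zu; rewrite zu uY in zY.
  case/andP=> uv pth zlast; have vX := resX _ _ uX uv.
  have [vY|vY] := boolP (v \in Y); first exact: (IHp v vY vX pth zlast).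
  case/existsP: uv => e /orP[] /andP[/andP[/eqP eu /eqP ev] _]; exists e;
    rewrite ?eu ?ev ?uX ?vX // !inE /= eu ev uY (negPf vY) //.
- by move=> y; rewrite inE; apply: conn_mono.
- rewrite sum_excess (eq_bigr (fun=> lo)); last first.
    move=> e; rewrite inE => /andP[tX hX]; apply/le_anti.
    have /andP[-> _] := gbox e; rewrite andbT leNgt; apply: contraNN hX => lt_lo.
    by apply: (resX _ _ tX); apply/existsP; exists e; rewrite !eqxx lt_lo.
  rewrite [X in _ - X](eq_bigr (fun=> hi)); last first.
    move=> e; rewrite inE /= => /andP[hX tX]; apply/le_anti.
    have /andP[_ ->] := gbox e; rewrite /= leNgt; apply: contraNN tX => lt_hi.
    by apply: (resX _ _ hX); apply/existsP; exists e; rewrite !eqxx lt_hi orbT.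
  by rewrite !sumr_const !mulr_natr.
Qed.

(** A circulation theorem in the style of Hoffman, where only the cuts around
    connected sets need to be checked.  Reversing the digraph keeps the
    minimizers and negates the excess, so the lower bound on the excess follows
    from the upper one. *)
Lemma bounded_excess_of_cuts D (lo hi alpha : R) : lo <= hi ->
  (forall x X, connected_from D x X ->
     lo * #|cut_out D X|%:R - hi * #|cut_in D X|%:R <= alpha * #|X|%:R /\
     lo * #|cut_in D X|%:R - hi * #|cut_out D X|%:R <= alpha * #|X|%:R) ->
  exists2 g, in_box lo hi g & forall x, `|excess D g x| <= alpha.
Proof.
move=> lohi cuts; have [g gmin] := minimizer_exists D lohi.
have upper D' x : minimizes_energy D' lo hi g ->
    (forall X, connected_from D' x X ->
      lo * #|cut_out D' X|%:R - hi * #|cut_in D' X|%:R <= alpha * #|X|%:R) ->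
    excess D' g x <= alpha.
  move=> gmin' cuts'; have [X [conn exX sumX]] := minimizer_tight_cut x gmin'.
  rewrite leNgt; apply/negP=> lt_al; have := cuts' X conn.
  apply/negP; rewrite -ltNge.
  have /lt_le_trans : alpha * #|X|%:R < excess D' g x * #|X|%:R.
    rewrite ltr_pM2r // ltr0n card_gt0.
    by apply/finset.set0Pn; exists x; case: conn.
  rewrite -sumX; apply.
  rewrite mulr_natr -sumr_const; exact: ler_sum.
exists g => [|x]; first by case: gmin.
rewrite ler_norml lerNl -excess_reverse; apply/andP; split; apply: upper => //.
- by case: gmin => gbox gmin; split=> // f /gmin; rewrite !energy_reverse.
- by move=> X /connected_from_reverse /cuts [].
- by move=> X /cuts [].
Qed.

(** * Cuts under a circular nowhere-zero flow *)

Lemma cnzf_cut D (r : R) f X : is_flow D r 0 f ->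
  #|cut_out D X|%:R <= (r - 1) * #|cut_in D X|%:R.
Proof.
case=> fbox fex.
have : \sum_(x in X) excess D f x = 0.
  by apply: big1 => x _; apply/eqP; rewrite -normr_le0; exact: fex.
rewrite sum_excess => /eqP; rewrite subr_eq0 => /eqP cut_eq.
rewrite -sumr_const mulr_natr -sumr_const.
apply: (@le_trans _ _ (\sum_(e in cut_out D X) f e)).
  by apply: ler_sum => e _; case/andP: (fbox e).
by rewrite cut_eq; apply: ler_sum => e _; case/andP: (fbox e).
Qed.

Lemma is_flow_reverse D (r alpha : R) f :
  is_flow D r alpha f -> is_flow (reverse D) r alpha f.
Proof. by case=> fbox fex; split=> // x; rewrite distrC; exact: fex. Qed.

(** Here [r < 5] makes [d+ < 4 d-] strict, and integrality turns this into
    [d+ + 1 <= 4 d-], which is exactly what offsets the [+ 2] in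
    [card_cut_connected]. *)
Lemma cnzf_connected_cut D (r : R) f x X :
  r < 5 -> is_flow D r 0 f -> (forall v, #|incident D v| <= 3)%N ->
  connected_from D x X ->
  1 * #|cut_out D X|%:R - 7 / 3 * #|cut_in D X|%:R <= 1 / 3 * #|X|%:R :> R.
Proof.
move=> r5 fD deg3 conn.
have bd : #|cut_out D X|%:R + #|cut_in D X|%:R <= #|X|%:R + 2 :> R.
  by rewrite -!natrD ler_nat (card_cut_connected deg3 conn).
have cut := cnzf_cut X fD.
have [in0|in_gt0] := posnP #|cut_in D X|.
  move: cut; rewrite in0 mulr0; have := ler0n R #|X|; lra.
suff : #|cut_out D X|%:R + 1 <= 4 * #|cut_in D X|%:R :> R by lra.
rewrite natr1 -natrM ler_nat -(ltr_nat R) natrM.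
apply: le_lt_trans cut _; rewrite ltr_pM2r ?ltr0n //; lra.
Qed.

End Excess.

Lemma degree_incident (V E : finType) (G : mgraph V E) (D : digraph V E) x :
  orientation G D -> #|incident D x| = degree G x.
Proof.
move=> GD; apply: eq_card => e.
by rewrite !inE GD !inE ![x == _]eq_sym.
Qed.

Theorem corollary21 (R : realType) (V E : finType) (G : mgraph V E)
    (Gcubic : cubic G) (Gbridgeless : bridgeless G)
    (Gphi : (circular_flow_number R G < (5 : R)%:E)%E) :
  admits_flow G (10 / 3 : R) (1 / 3 : R).
Proof.
have [_ [r [_ [D [GD [f fD]]]] <-]] := ereal_inf_lt Gphi; rewrite lte_fin => r5.
have deg3 v : (#|incident D v| <= 3)%N by rewrite (degree_incident _ GD) Gcubic.
have [||g gbox gex] := @bounded_excess_of_cuts R V E D 1 (7 / 3) (1 / 3).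
- by lra.
- move=> x X conn; split; first exact: cnzf_connected_cut r5 fD deg3 conn.
  have deg3' v : (#|incident (reverse D) v| <= 3)%N.
    rewrite (_ : incident _ v = incident D v) //.
    by apply/setP=> e; rewrite !inE orbC.
  exact: cnzf_connected_cut r5 (is_flow_reverse fD) deg3' (connected_from_reverse conn).
- exists D; split=> //; exists g; split=> // e.
  by have -> : 10 / 3 - 1 = 7 / 3 :> R by lra.
Qed.
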